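(* Let $f:2^V\to\mathbb{R}_{\ge0}$ be monotone submodular with $f(\{v\})>0$ for all $v\in V$, let $k,W\ge1$ be integers, let $\epsilon>0$, and let $v_1,v_2,\dots$ be a stream of elements of $V$. Run the Submodular Smooth Histograms algorithm (described in the context) with $\beta=\delta=\epsilon/2$ and window size $W$. Then at every time $t$, the returned value satisfies $\mathsf{Solution}_t\ge(\tfrac13-\epsilon)\,f_k(A_t)$, and it is the value $f(S)$ of a set $S\subseteq A_t$ with $|S|\le k$; i.e., the algorithm is a $(\tfrac13-\epsilon)$-approximation for maximizing $f$ subject to a cardinality constraint $k$ over the sliding window of the last $W$ elements.
   Context: Active window at time $t$: $A_t=\{v_{\max(1,t-W+1)},\dots,v_t\}$. $f_k(A)=\max_{S\subseteq A,|S|\le k}f(S)$. Notation: $f'_S(v)=f(S\cup\{v\})-f(S)$; $\Delta=\max_{v\in V}f(\{v\})$. Algorithm $\mathsf{StreamAllThresholds}$ with parameter $\delta$ on a stream $u_1,u_2,\dots$: let $m=\lfloor\log_{1+\delta}(2k\Delta/f(\{u_1\}))\rfloor$ and $T=\{(1+\delta)^jf(\{u_1\})/(2k): j=0,\dots,m\}$; for each $\tau\in T$ keep $S_\tau$, initially empty; upon arrival of $u_t$, for each $\tau\in T$, if $f'_{S_\tau}(u_t)\ge\tau$ and $|S_\tau|<k$, add $u_t$ to $S_\tau$; its current output is $\max_{\tau\in T}f(S_\tau)$ (attained by one of the sets $S_\tau$). For $a\le b$, $h(a,b)$ is the output of $\mathsf{StreamAllThresholds}$ run on $v_a,\dots,v_b$.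 Submodular Smooth Histograms algorithm (parameters $\beta,\delta,W$): it maintains indices $x_1<\dots<x_s$ (initially $s=0$), each with a running instance of $\mathsf{StreamAllThresholds}$ (parameter $\delta$) on the substream starting at $v_{x_i}$, whose output after processing $v_t$ is $h(x_i,t)$. At each time $t=1,2,\dots$: (1) set $s\leftarrow s+1$, $x_s\leftarrow t$, start a new instance starting at $v_t$; (2) for each $1\le i<s$, if $x_{i+1}<t-W+1$, remove $x_i$ and its instance (re-index, $s\leftarrow s-1$); (3) pass $v_t$ to all instances; (4) while there exists $1\le i\le s-2$ with $h(x_{i+2},t)\ge(1-\beta)h(x_i,t)$, remove $x_{i+1}$ and its instance (re-index, $s\leftarrow s-1$); (5) output $\mathsf{Solution}_t=h(x_1,t)$ if $x_1=\max(1,t-W+1)$, otherwise $\mathsf{Solution}_t=h(x_2,t)$. *)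

(* Defs.v *)
From mathcomp Require Import all_boot all_order all_algebra.
From mathcomp Require Import boolp reals exp.

Set Implicit Arguments.
Unset Strict Implicit.
Unset Printing Implicit Defensive.

Import Order.TTheory GRing.Theory Num.Theory.
Local Open Scope ring_scope.

Section SetFunctions.
Context {R : realType} {V : finType}.
Implicit Types (f : {set V} -> R) (S A : {set V}).

Definition nonneg_setfun f := forall S, 0 <= f S.

Definition monotone f := forall S T : {set V}, S \subset T -> f S <= f T.

Definition marginal f S (u : V) : R := f (u |: S) - f S.

Definition submodular f := forall (S T : {set V}) (u : V),
  S \subset T -> u \notin T -> marginal f T u <= marginal f S u.

(* In the maxima below the default value 0 is harmless since f is nonnegative. *)
Definition max_singleton f : R := \big[Num.max/0]_(u : V) f [set u].

Definition opt f (k : nat) A : R :=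
  \big[Num.max/0]_(S : {set V} | (S \subset A) && (#|S| <= k)%N) f S.

End SetFunctions.

Section StreamAllThresholds.
Context {R : realType} {V : finType}.
Variables (f : {set V} -> R) (k : nat) (delta : R).

(* The logarithm is nonnegative when 0 < f [set u1], 0 < k and 0 < delta, and
   Num.truncn is the floor on nonnegative reals. *)
Definition max_exponent (u1 : V) : nat :=
  Num.truncn (ln (2 * k%:R * max_singleton f / f [set u1]) / ln (1 + delta)).

Definition thresholds (u1 : V) : seq R :=
  [seq (1 + delta) ^+ j * f [set u1] / (2 * k%:R)
     | j <- iota 0 (max_exponent u1).+1].

Definition threshold_step (tau : R) (S : {set V}) (u : V) : {set V} :=
  if (tau <= marginal f S u) && (#|S| < k)%N then u |: S else S.

Definition threshold_set (tau : R) (us : seq V) : {set V} :=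
  foldl (threshold_step tau) set0 us.

(* Current output after the elements of us have arrived; an instance is never
   queried before its first element, so the value on [::] is irrelevant. *)
Definition stream_all_thresholds (us : seq V) : R :=
  if us is u1 :: _ then
    \big[Num.max/0]_(tau <- thresholds u1) f (threshold_set tau us)
  else 0.

End StreamAllThresholds.

(* Streams v_1, v_2, ... are functions on nat whose value at 0 is never used. *)
Definition substream {V : Type} (v : nat -> V) (a b : nat) : seq V :=
  [seq v i | i <- index_iota a b.+1].

(* max(1, t - W + 1); the truncated subtraction agrees with the integer one
   here, as it does in [expire] below, where indices are at least 1. *)
Definition window_start (W t : nat) : nat := maxn 1 (t.+1 - W).

Definition window {V : finType} (v : nat -> V) (W t : nat) : {set V} :=
  [set x in substream v (window_start W t) t].

Section SmoothHistogram.
Context {R : realType} {V : finType}.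
Variables (f : {set V} -> R) (k : nat) (beta delta : R) (W : nat).
Variable v : nat -> V.

Definition h (a b : nat) : R :=
  stream_all_thresholds f k delta (substream v a b).

(* The state of the algorithm is the list [:: x_1; ...; x_s]; the instance
   attached to x_i is determined by x_i and the elements read so far. *)

(* Drop every index whose successor in the list precedes the window. *)
Fixpoint expire (t : nat) (xs : seq nat) : seq nat :=
  if xs is x :: xs' then
    if xs' is y :: _ then
      if (y < t.+1 - W)%N then expire t xs' else x :: expire t xs'
    else xs
  else [::].

(* One iteration of the pruning loop, with x = x_i, y = x_(i+1), z = x_(i+2). *)
Definition prune1 (t : nat) (xs ys : seq nat) : Prop :=
  exists (p q : seq nat) (x y z : nat),
    [/\ xs = p ++ [:: x, y, z & q],
        (1 - beta) * h x t <= h z t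
      & ys = p ++ [:: x, z & q]].

(* Complete executions of the pruning loop. The order of removals is not
   prescribed, hence a relation. *)
Inductive prune (t : nat) : seq nat -> seq nat -> Prop :=
| prune_exit xs : (forall ys, ~ prune1 t xs ys) -> prune t xs xs
| prune_iter xs ys zs : prune1 t xs ys -> prune t ys zs -> prune t xs zs.

Definition histogram_step (t : nat) (xs ys : seq nat) : Prop :=
  prune t (expire t (rcons xs t)) ys.

(* X t is the list of indices at the end of time step t. *)
Definition histogram_run (X : nat -> seq nat) : Prop :=
  X 0%N = [::] /\ forall t, histogram_step t.+1 (X t) (X t.+1).

(* nth is 0-based: these are x_1 and x_2. *)
Definition solution (xs : seq nat) (t : nat) : R :=
  if nth 0%N xs 0 == window_start W t then h (nth 0%N xs 0) t
  else h (nth 0%N xs 1) t.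

(* The pruning loop always terminates, and runs exist. *)
Lemma prune_total t xs : exists ys, prune t xs ys.
Proof.
have [n] := ubnP (size xs); elim: n xs => // n IHn xs /ltnSE le_xs_n.
have [[ys prune_xs_ys]|no_prune] := pselect (exists ys, prune1 t xs ys).
  have [|zs prune_ys_zs] := IHn ys; last first.
    by exists zs; apply: prune_iter prune_xs_ys prune_ys_zs.
  case: prune_xs_ys le_xs_n => p [q [x [y [z [-> _ ->]]]]].
  by rewrite !size_cat /= !addnS.
by exists xs; apply: prune_exit => ys prune_xs_ys; case: no_prune; exists ys.
Qed.

Lemma histogram_run_exists : exists X, histogram_run X.
Proof.
have stepE (p : nat * seq nat) : exists ys, histogram_step p.1 p.2 ys.
  exact: prune_total.
have [g gP] := choice stepE.
exists (fix X t := if t is t'.+1 then g (t, X t') else [::]).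
by split=> // t; apply: (gP (t.+1, _)).
Qed.

End SmoothHistogram.

(* Main.v *)
(* Let M be the optimum of the window and let an instance have read us. Some
   threshold tau satisfies M / (3k) < (1 + delta) tau and tau <= M / (3k),
   unless M < (3/2) f {u_1}, where f {u_1} / 2 already suffices. If S_tau is
   full, the output is at least k tau; otherwise every element of us has
   marginal at most tau over S_tau, so f A <= output + |A| M / (3k) for every A
   within us.

   Suppose that x_1 < x_2 straddle the start of the window and are not
   consecutive. They became neighbours by pruning at a time t' such that
   (1 - beta) h(x_1, t') <= h(x_2, t'). Split the optimal set into the part
   read by instance x_1 up to t' and the rest, read by instance x_2: unless some
   S_tau is full, M <= h(x_1, t') + h(x_2, t) + M / 3, whence h(x_2, t) is about
   M / 3, as h(x_1, t') <= h(x_2, t) / (1 - beta). *)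

Require Import Defs.
From mathcomp Require Import all_boot all_order all_algebra.
From mathcomp Require Import boolp reals exp.
From mathcomp Require Import ring lra zify.

Import Order.TTheory GRing.Theory Num.Theory.
Local Open Scope ring_scope.

Set Implicit Arguments.
Unset Strict Implicit.
Unset Printing Implicit Defensive.

(** * Monotone submodular set functions *)

Section SubmodularFunctions.
Context {R : realType} {V : finType} (f : {set V} -> R).
Hypotheses (f_nonneg : nonneg_setfun f) (f_mono : monotone f).
Hypothesis f_submod : submodular f.

Lemma marginal_in (S : {set V}) (u : V) : u \in S -> marginal f S u = 0.
Proof. by move=> uS; rewrite /marginal setUC (setUidPl _) ?subrr ?sub1set. Qed.

(** The case [u \in T], excluded in [submodular], follows from monotonicity: the left side vanishes
    and the right side is nonnegative. *)
Lemma marginal_anti (S T : {set V}) (u : V) :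
  S \subset T -> marginal f T u <= marginal f S u.
Proof.
move=> sST; have [uT|uT] := boolP (u \in T); last exact: f_submod.
by rewrite marginal_in // subr_ge0 f_mono // subsetUr.
Qed.

(** Insert the elements of [A] one by one: each marginal over the growing set is at most the one
    over [S]. *)
Lemma setfun_union_marginal (S A : {set V}) (c : R) :
  {in A, forall u, marginal f S u <= c} -> f (S :|: A) <= f S + #|A|%:R * c.
Proof.
have le_seq s : {in s, forall u, marginal f S u <= c} ->
    f (S :|: [set:: s]) <= f S + (size s)%:R * c.
  elim: s => [_|u s IHs le_c]; first by rewrite set_nil setU0 mul0r addr0.
  have le_s : f (S :|: [set:: s]) <= f S + (size s)%:R * c.
    by apply: IHs => w ws; apply: le_c; rewrite inE ws orbT.
  have le_u : marginal f (S :|: [set:: s]) u <= c.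
    by rewrite (le_trans (marginal_anti u (subsetUl S _))) ?le_c ?inE ?eqxx.
  rewrite set_cons setUCA /= -natr1 mulrDl mul1r.
  by move: le_u; rewrite /marginal; lra.
move=> le_c; rewrite cardE -{1}(set_enum A).
by apply: le_seq => u; rewrite mem_enum => /le_c.
Qed.

Lemma setfun_subadd (A B : {set V}) : f (A :|: B) <= f A + f B.
Proof.
rewrite -(set_enum B); elim: (enum B) => [|u s IHs].
  by rewrite set_nil setU0 lerDl f_nonneg.
have := marginal_anti u (subsetUr A [set:: s]).
by rewrite set_cons setUCA /marginal; lra.
Qed.

Lemma le_max_singleton (u : V) : f [set u] <= max_singleton f.
Proof. exact: le_bigmax. Qed.

Lemma setfun_le_max_singleton (u0 : V) (k : nat) (A : {set V}) :
  (1 <= k)%N -> (#|A| <= k)%N -> f A <= k%:R * max_singleton f.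
Proof.
move=> k_ge1 leAk; pose D := max_singleton f.
have D_ge0 : 0 <= D by exact: le_trans (f_nonneg _) (le_max_singleton u0).
(* [f set0] may be positive, so the empty list is charged one [D], through the singleton of [u0];
   hence [maxn 1]. *)
have le_seq s : f [set:: s] <= (maxn 1 (size s))%:R * D.
  elim: s => [|u s IHs].
    by rewrite mul1r (le_trans _ (le_max_singleton u0)) ?f_mono ?set_nil ?sub0set.
  case: s IHs => [|w s] IHs.
    by rewrite set_cons set_nil setU0 mul1r le_max_singleton.
  rewrite set_cons (le_trans (setfun_subadd _ _)) //.
  have -> : maxn 1 (size [:: u, w & s]) = (maxn 1 (size (w :: s))).+1.
    by rewrite !(maxn_idPr _).
  by rewrite -natr1 mulrDl mul1r addrC lerD ?le_max_singleton.
rewrite -(set_enum A) (le_trans (le_seq _)) // ler_wpM2r // ler_nat.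
by rewrite -cardE geq_max k_ge1.
Qed.

Lemma opt_attained (k : nat) (A : {set V}) :
  exists O : {set V}, [/\ O \subset A, (#|O| <= k)%N & opt f k A = f O].
Proof.
rewrite /opt; have [||O /andP[sOA leOk] ->] := @eq_bigmax _ _ _ (0 : R) (set0 : {set V})
  (fun S => (S \subset A) && (#|S| <= k)%N) f.
- by rewrite sub0set cards0.
- by move=> S _; apply: f_nonneg.
by exists O.
Qed.

(** * Thresholding along a single stream *)

Section Streams.
Context (k : nat).

Lemma threshold_set_rcons (tau : R) (us : seq V) (u : V) :
  threshold_set f k tau (rcons us u) =
  threshold_step f k tau (threshold_set f k tau us) u.
Proof. by rewrite /threshold_set foldl_rcons. Qed.

Lemma threshold_step_sub (tau : R) (S : {set V}) (u : V) :
  S \subset threshold_step f k tau S u.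
Proof. by rewrite /threshold_step; case: ifP => // _; apply: subsetUr. Qed.

Lemma threshold_set_cat (tau : R) (us ws : seq V) :
  threshold_set f k tau us \subset threshold_set f k tau (us ++ ws).
Proof.
elim/last_ind: ws => [|ws w IHws]; first by rewrite cats0.
rewrite -rcons_cat threshold_set_rcons.
exact: subset_trans IHws (threshold_step_sub _ _ _).
Qed.

Lemma threshold_set_sub (tau : R) (us : seq V) :
  threshold_set f k tau us \subset us.
Proof.
elim/last_ind: us => [|us u IHus]; first by apply/subsetP => w; rewrite inE.
have sSu : threshold_set f k tau us \subset rcons us u.
  by apply/subsetP => w /(subsetP IHus) wus; rewrite mem_rcons inE wus orbT.
rewrite threshold_set_rcons /threshold_step; case: ifP => // _.
by apply/subsetP => w /setU1P[->|/(subsetP sSu) //]; rewrite mem_rcons mem_head.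
Qed.

Lemma threshold_set_card (tau : R) (us : seq V) :
  (#|threshold_set f k tau us| <= k)%N.
Proof.
elim/last_ind: us => [|us u IHus]; first by rewrite cards0.
rewrite threshold_set_rcons /threshold_step; case: ifP => // /andP[_ ltSk].
by rewrite cardsU1 (leq_trans _ ltSk) // -add1n leq_add2r leq_b1.
Qed.

Lemma threshold_set_value (tau : R) (us : seq V) : 0 <= tau ->
  #|threshold_set f k tau us|%:R * tau <= f (threshold_set f k tau us).
Proof.
move=> tau_ge0; elim/last_ind: us => [|us u IHus].
  by rewrite cards0 mul0r.
rewrite threshold_set_rcons /threshold_step; case: ifP => // /andP[le_tau _].
rewrite cardsU1; set S := threshold_set _ _ _ _ in le_tau IHus *.
have le1 : ((u \notin S : nat)%:R * tau <= tau :> R).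
  by case: (u \notin S); rewrite ?mul1r ?mul0r.
by move: le_tau; rewrite natrD mulrDl /marginal; lra.
Qed.

(** The sets only grow, so a set that is not full at the end never was: an element was rejected only
    for a marginal below [tau], which later growth can only decrease. An accepted element has final
    marginal 0. *)
Lemma threshold_set_marginal (tau : R) (us : seq V) : 0 <= tau ->
  (#|threshold_set f k tau us| < k)%N ->
  {in us, forall u, marginal f (threshold_set f k tau us) u <= tau}.
Proof.
move=> tau_ge0; elim/last_ind: us => // us u IHus.
rewrite threshold_set_rcons; set S := threshold_set _ _ _ _ in IHus * => ltk w.
have sS : S \subset threshold_step f k tau S u by exact: threshold_step_sub.
have ltSk : (#|S| < k)%N by apply: leq_ltn_trans (subset_leq_card sS) ltk.
rewrite mem_rcons inE => /orP[/eqP ->|wus]; last first.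
  exact: le_trans (marginal_anti w sS) (IHus ltSk w wus).
rewrite /threshold_step ltSk andbT; case: (lerP tau (marginal f S u)) => [_|/ltW //].
by rewrite marginal_in // setU11.
Qed.

Context (delta : R).
Local Notation sat := (stream_all_thresholds f k delta).

Definition threshold (u : V) (j : nat) : R :=
  (1 + delta) ^+ j * f [set u] / (2 * k%:R).

Lemma streamE (u : V) (us : seq V) :
  sat (u :: us) = \big[Num.max/0]_(j < (max_exponent f k delta u).+1)
                    f (threshold_set f k (threshold u j) (u :: us)).
Proof.
rewrite /= /thresholds big_map -[iota _ _]/(index_iota 0 _.+1).
by rewrite big_mkord.
Qed.

Lemma le_stream (u : V) (us : seq V) (j : nat) :
  (j <= max_exponent f k delta u)%N ->
  f (threshold_set f k (threshold u j) (u :: us)) <= sat (u :: us).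
Proof.
rewrite -ltnS streamE => ltj.
exact: (@bigmax_sup _ _ _ _ (Ordinal ltj)).
Qed.

(** The grid of thresholds depends only on the first element, so both outputs are maxima over the
    same thresholds. *)
Lemma stream_cat (us ws : seq V) : us != [::] -> sat us <= sat (us ++ ws).
Proof.
case: us => // u us _; rewrite cat_cons !streamE; apply: le_bigmax2 => j _.
by apply: f_mono; rewrite -cat_cons; apply: threshold_set_cat.
Qed.

Lemma stream_attained (us : seq V) : us != [::] ->
  exists S : {set V}, [/\ S \subset us, (#|S| <= k)%N & sat us = f S].
Proof.
case: us => // u us _; rewrite streamE.
have [//|i _|j _ ->] := @eq_bigmax _ _ _ (0 : R)
  (ord0 : 'I_(max_exponent f k delta u).+1) xpredT
  (fun j => f (threshold_set f k (threshold u j) (u :: us))); first exact: f_nonneg.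
by exists (threshold_set f k (threshold u j) (u :: us)); split;
  rewrite ?threshold_set_sub ?threshold_set_card.
Qed.

Hypotheses (k_ge1 : (1 <= k)%N) (delta_gt0 : 0 < delta).
Hypothesis f_pos : forall u : V, 0 < f [set u].

Lemma natk_ge1 : 1 <= k%:R :> R.
Proof. by rewrite ler1n. Qed.

(* When the first element is rejected by the lowest threshold, f set0 itself is
   at least half of its value. *)
Lemma stream_ge_head (u : V) (us : seq V) : f [set u] / 2 <= sat (u :: us).
Proof.
have k1 := natk_ge1; have fu := f_pos u.
have tau_le : threshold u 0 <= f [set u] / 2.
  rewrite /threshold expr0 mul1r invfM mulrA ler_pdivrMr; last by lra.
  by rewrite ler_peMr //; lra.
apply: le_trans (le_stream us (leq0n _)).
have sub1 : threshold_set f k (threshold u 0) [:: u] \subset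
            threshold_set f k (threshold u 0) (u :: us).
  exact: (threshold_set_cat _ [:: u] us).
apply: le_trans (f_mono sub1).
rewrite /threshold_set /= /threshold_step cards0 k_ge1 andbT /marginal setU0.
by case: ifP => [_|/negbT]; rewrite -?ltNge; lra.
Qed.

Lemma exponent_bounds (q : R) (j := Num.truncn (ln q / ln (1 + delta))) :
  1 <= q -> (1 + delta) ^+ j <= q < (1 + delta) ^+ j.+1.
Proof.
move=> q_ge1; have lnd : 0 < ln (1 + delta) by rewrite ln_gt0 ?ltrDl.
have q_gt0 : 0 < q by lra.
have d_gt0 i : 0 < (1 + delta) ^+ i by rewrite exprn_gt0 ?addr_gt0.
have /truncn_itv/andP[jle ltj] : 0 <= ln q / ln (1 + delta).
  by rewrite divr_ge0 ?(ltW lnd) ?ln_ge0.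
have d1_gt0 : 0 < 1 + delta by rewrite addr_gt0.
rewrite -ler_ln ?posrE // -ltr_ln ?posrE // !lnXn //.
rewrite -[_ *+ j]mulr_natl -[_ *+ j.+1]mulr_natl; apply/andP; split.
  by rewrite -ler_pdivlMr.
by rewrite -ltr_pdivrMr.
Qed.

(** [M] is not tied to [us]: it will be the value of an optimal set of the window, of which [us] may
    contain only a part. *)
Lemma stream_bound (M : R) (u : V) (us : seq V) :
  0 <= M <= k%:R * max_singleton f ->
  M <= 3 * (1 + delta) * sat (u :: us) \/
  forall A : {set V}, A \subset u :: us ->
    f A <= sat (u :: us) + #|A|%:R * (M / (3 * k%:R)).
Proof.
move=> /andP[M_ge0 M_le]; have k1 := natk_ge1; have fu := f_pos u.
have hd := stream_ge_head u us; set s := sat _ in hd *.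
have s_gt0 : 0 < s by lra.
have ds : 0 < delta * s by apply: mulr_gt0.
have [M_small|M_large] := ltrP M (3 / 2 * f [set u]).
  by left; rewrite -mulrA mulrDl; lra.
(* Chosen so that [q * f [set u] / (2 * k%:R)] is the target threshold [M / (3 * k%:R)]. The bound
   on [M] by [max_singleton] keeps the exponent [j] of the power of [1 + delta] just below [q]
   inside the grid. *)
pose q := 2 * M / (3 * f [set u]).
have q_ge1 : 1 <= q by rewrite /q ler_pdivlMr; lra.
have q_le : q <= 2 * k%:R * max_singleton f / f [set u].
  have -> : q = 2 / 3 * M / f [set u] by rewrite /q; field; rewrite gt_eqF.
  by rewrite ler_wpM2r ?invr_ge0 ?(ltW fu) //; lra.
have [j [lej ltj lejm]] : exists j, [/\ (1 + delta) ^+ j <= q,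
    q < (1 + delta) ^+ j.+1 & (j <= max_exponent f k delta u)%N].
  have /andP[lej ltj] := exponent_bounds q_ge1.
  exists (Num.truncn (ln q / ln (1 + delta))); split=> //.
  apply: le_truncn; rewrite ler_wpM2r ?invr_ge0 ?ln_ge0 ?lerDl ?(ltW delta_gt0) //.
  rewrite ler_ln ?posrE.
  - exact: q_le.
  - exact: lt_le_trans ltr01 q_ge1.
  - exact: lt_le_trans (lt_le_trans ltr01 q_ge1) q_le.
set tau := threshold u j.
have k_gt0 : 0 < k%:R :> R by exact: lt_le_trans ltr01 k1.
have k2_ge0 : 0 <= (2 * k%:R)^-1 :> R by rewrite invr_ge0 ltW // mulr_gt0.
have d1_ge0 : 0 <= 1 + delta by rewrite ltW // addr_gt0.
have qE : q * f [set u] / (2 * k%:R) = M / (3 * k%:R).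
  by rewrite /q; field; rewrite !gt_eqF.
have tau_ge0 : 0 <= tau.
  by rewrite /tau /threshold !mulr_ge0 ?exprn_ge0 ?(ltW fu).
have tau_le : tau <= M / (3 * k%:R).
  by rewrite -qE /tau /threshold !ler_wpM2r ?(ltW fu).
have tau_lt : M / (3 * k%:R) <= (1 + delta) * tau.
  by rewrite -qE /tau /threshold !mulrA -exprS !ler_wpM2r ?(ltW fu) // ltW.
have le_s : f (threshold_set f k tau (u :: us)) <= s by apply: le_stream.
have [ltk|] := ltnP #|threshold_set f k tau (u :: us)| k.
  right=> A /subsetP sAus.
  set S := threshold_set f k tau (u :: us) in le_s ltk *.
  have le_f : f (S :|: A) <= f S + #|A|%:R * tau.
    apply: setfun_union_marginal => w /sAus.
    exact: threshold_set_marginal.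
  have le_A : #|A|%:R * tau <= #|A|%:R * (M / (3 * k%:R)).
    by rewrite ler_wpM2l.
  apply: le_trans (f_mono (subsetUr S A)) _.
  by apply: le_trans le_f _; apply: lerD.
move=> gek; left.
have ktau : k%:R * tau <= s.
  apply: le_trans le_s; apply: le_trans (threshold_set_value _ tau_ge0).
  by rewrite ler_wpM2r // ler_nat.
move: tau_lt; rewrite ler_pdivrMr ?mulr_gt0 //.
have : (1 + delta) * (k%:R * tau) <= (1 + delta) * s by rewrite ler_wpM2l.
by lra.
Qed.

End Streams.
End SubmodularFunctions.

Lemma mem_substream {V : eqType} (v : nat -> V) (a b : nat) (u : V) :
  reflect (exists2 i, (a <= i <= b)%N & u = v i) (u \in substream v a b).
Proof.
apply: (iffP mapP) => -[i]; rewrite ?mem_index_iota => iab ->; exists i => //.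
by rewrite mem_index_iota.
Qed.

Lemma substream_cons {V : Type} (v : nat -> V) (a b : nat) : (a <= b)%N ->
  substream v a b = v a :: substream v a.+1 b.
Proof. by move=> leab; rewrite /substream /index_iota subSn // subSS. Qed.

Lemma substream_cat {V : Type} (v : nat -> V) (a b c : nat) :
  (a <= b <= c)%N -> substream v a c = substream v a b ++ substream v b.+1 c.
Proof.
move=> /andP[leab lebc]; rewrite /substream /index_iota -map_cat.
have -> : (c.+1 - a = (b.+1 - a) + (c.+1 - b.+1))%N by lia.
by rewrite iotaD subnKC // leqW.
Qed.

(** * Smooth pairs of instances, and the invariant of a run *)

Section Histogram.
Context {R : realType} {V : finType} (f : {set V} -> R).
Hypotheses (f_nonneg : nonneg_setfun f) (f_mono : monotone f).
Hypotheses (f_submod : submodular f) (f_pos : forall u : V, 0 < f [set u]).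
Context (k W : nat) (beta : R) (v : nat -> V).
Hypotheses (k_ge1 : (1 <= k)%N) (beta_gt0 : 0 < beta).
Local Notation hh := (h f k beta v).

Lemma h_attained (a b : nat) : (a <= b)%N ->
  exists S : {set V}, [/\ S \subset substream v a b, (#|S| <= k)%N & hh a b = f S].
Proof.
by move=> leab; apply: stream_attained; rewrite // substream_cons.
Qed.

Lemma h_ge0 (a b : nat) : (a <= b)%N -> 0 <= hh a b.
Proof. by case/h_attained => S [_ _ ->]; apply: f_nonneg. Qed.

Lemma h_mono (a b c : nat) : (a <= b <= c)%N -> hh a b <= hh a c.
Proof.
move=> /[dup] /andP[leab _] leabc; rewrite /h (substream_cat v leabc).
by apply: stream_cat; rewrite // substream_cons.
Qed.

Lemma h_bound (M : R) (a b : nat) : (a <= b)%N ->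
  0 <= M <= k%:R * max_singleton f ->
  M <= 3 * (1 + beta) * hh a b \/
  forall A : {set V}, A \subset substream v a b ->
    f A <= hh a b + #|A|%:R * (M / (3 * k%:R)).
Proof. by move=> leab; rewrite /h substream_cons //; apply: stream_bound. Qed.

(** The case [x = y], [t' = t] is allowed and gives the guarantee for one instance that starts
    exactly with the window. *)
Lemma smooth_bound (x y t' t : nat) (O : {set V}) :
  (x <= y)%N -> (y <= t' <= t)%N -> (1 - beta) * hh x t' <= hh y t' ->
  O \subset substream v x t -> (#|O| <= k)%N ->
  (1 / 3 - 2 * beta) * f O <= hh y t.
Proof.
move=> lexy /[dup] /andP[leyt' let't] leyt't smooth sOxt leOk.
have leyt : (y <= t)%N by exact: leq_trans let't.
have H_ge0 := h_ge0 leyt; have G_ge0 := h_ge0 (leq_trans lexy leyt').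
have {smooth} : (1 - beta) * hh x t' <= hh y t.
  exact: le_trans smooth (h_mono leyt't).
have M_ge0 := f_nonneg O.
have M_bounds : 0 <= f O <= k%:R * max_singleton f.
  by rewrite M_ge0 (setfun_le_max_singleton f_nonneg f_mono f_submod (v 0)).
(* For [beta] at least 1/6 the factor is nonpositive and the claim is trivial. *)
have [beta_big|beta_small] := lerP (1 / 3) (2 * beta).
  by move=> _; apply: le_trans H_ge0; rewrite mulr_le0_ge0 // subr_le0.
move=> smooth; have beta_ge0 := ltW beta_gt0.
(* The constants fit since [(1 / 3 - 2 * beta) * 3 * (1 + beta) = 1 - 5 * beta - 6 * beta ^+ 2], at
   most [1 - beta]. *)
have bound_large (x0 : R) : 0 <= x0 -> f O <= 3 * (1 + beta) * x0 ->
    (1 / 3 - 2 * beta) * f O <= (1 - beta) * x0.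
  move=> x0_ge0 le_x0; have := mulr_ge0 beta_ge0 x0_ge0.
  have := mulr_ge0 (sqr_ge0 beta) x0_ge0.
  have : 0 <= (1 / 3 - 2 * beta) * (3 * (1 + beta) * x0 - f O).
    by rewrite mulr_ge0 // subr_ge0 // ltW.
  by lra.
have [leG|boundG] := h_bound (leq_trans lexy leyt') M_bounds.
  exact: le_trans (bound_large _ G_ge0 leG) smooth.
have [leH|boundH] := h_bound leyt M_bounds.
  by apply: le_trans (bound_large _ H_ge0 leH) _; rewrite ler_piMl //; lra.
pose A := O :&: [set u in substream v x t'].
have {}boundG : f A <= hh x t' + #|A|%:R * (f O / (3 * k%:R)).
  by apply: boundG; apply/subsetP => u /setIP[_]; rewrite inE.
have {}boundH : f (O :\: A) <= hh y t + #|O :\: A|%:R * (f O / (3 * k%:R)).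
  apply: boundH; apply/subsetP => u; rewrite !inE => /andP[uA uO].
  (* A position before [y] is at most [t'], which would put the element in [A]. *)
  have /mem_substream[i /andP[lexi leit] uE] := subsetP sOxt u uO.
  apply/mem_substream; exists i => //; rewrite leit andbT.
  rewrite leqNgt; apply: contra uA => ltiy; rewrite uO.
  by apply/mem_substream; exists i => //; rewrite lexi (leq_trans (ltnW ltiy)).
have fO : f O <= f A + f (O :\: A).
  rewrite -{1}(setID O A) (setIidPr (subsetIl _ _)).
  exact: setfun_subadd.
have cardO : #|A|%:R * (f O / (3 * k%:R)) + #|O :\: A|%:R * (f O / (3 * k%:R)) <= f O / 3.
  have k_gt0 : 0 < k%:R :> R by rewrite ltr0n.
  rewrite -mulrDl -natrD mulrA ler_pdivrMr ?mulr_gt0 //.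
  have -> : f O / 3 * (3 * k%:R) = k%:R * f O by field.
  rewrite ler_wpM2r // ler_nat.
  by rewrite -(cardsID A O) (setIidPr (subsetIl _ _)) in leOk.
move: (#|A|%:R * _) (#|O :\: A|%:R * _) boundG boundH fO cardO.
move: (f A) (f (O :\: A)) => fA fB a b *.
have : 2 / 3 * f O <= hh x t' + hh y t by lra.
(* Multiplying by [1 - beta] and using [smooth] gives [(1 - beta) * (2 / 3) * f O <= (2 - beta) * hh
   y t]. *)
move=> sum_ge; have := mulr_ge0 beta_ge0 H_ge0; have := mulr_ge0 beta_ge0 M_ge0.
have : 0 <= (1 - beta) * (hh x t' + hh y t - 2 / 3 * f O).
  by rewrite mulr_ge0 ?subr_ge0 //; lra.
by lra.
Qed.

(** The smoothness inequality is recorded at the past time [t'] of the pruning that made [x] and [y]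
    neighbours, as it may fail at [t]. *)
Definition adjacent (t x y : nat) : Prop :=
  [/\ (x < y)%N, (y <= t)%N & y = x.+1 \/
    exists2 t', (y <= t' <= t)%N & (1 - beta) * hh x t' <= hh y t'].

Local Notation adj t := (fun x y => `[< adjacent t x y >]).

Lemma adjacentS (t x y : nat) : adjacent t x y -> adjacent t.+1 x y.
Proof.
move=> [ltxy leyt adjxy]; split=> //; first exact: leqW.
case: adjxy => [->|[t' /andP[leyt' let't] smooth]]; [by left|right].
by exists t' => //; rewrite leyt' leqW.
Qed.

(** With default 0 for [last] and [head], the empty list satisfies this at time 0 and at no later
    time. *)
Definition histogram_inv (t : nat) (xs : seq nat) : Prop :=
  [/\ sorted (adj t) xs, last 0 xs = t, (head 0 xs <= window_start W t)%N
    & all (leq (t.+1 - W)) (behead xs)]%N.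

Lemma expire_id (t : nat) (xs : seq nat) :
  all (leq (t.+1 - W)) (behead xs) -> expire W t xs = xs.
Proof.
elim: xs => // x [|y l] IHxs //= /andP[ley lel].
by rewrite ltnNge ley /=; congr cons; apply: IHxs.
Qed.

(** Dropping [x] exposes a successor that still precedes the window. Once the successor does not,
    the increasing order puts all later indices in the window and nothing more is dropped. *)
Lemma expire_inv (t : nat) (xs : seq nat) :
  sorted (adj t) xs -> last 0%N xs = t -> (head 0 xs <= window_start W t)%N ->
  histogram_inv t (expire W t xs).
Proof.
elim: xs => [|x [|y l] IHxs] // sxs lastxs headxs.
rewrite [expire _ _ _]/=; case: ltnP => [lty|ley].
  apply: IHxs => //; first exact: path_sorted sxs.
  by rewrite /= /window_start leq_max (ltnW lty) orbT.
have all_ge : all (leq (t.+1 - W)) (y :: l).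
  have lt_l : path ltn y l.
    by move: sxs => /andP[_]; apply: sub_path => a b /asboolP[].
  rewrite /= ley /=; apply: sub_all (order_path_min ltn_trans lt_l) => z.
  by move=> /ltnW; apply: leq_trans.
by rewrite -/(expire W t (y :: l)) expire_id //; case/andP: all_ge.
Qed.

(** The inequality just tested certifies the new pair [x], [z] with [t' = t]; the first and last
    indices survive because only a middle one is removed. *)
Lemma prune1_inv (t : nat) (xs ys : seq nat) :
  prune1 f k beta beta v t xs ys -> histogram_inv t xs -> histogram_inv t ys.
Proof.
case=> p [q [x [y [z [-> smooth ->]]]]] [sxs lastxs headxs allxs]; split.
- move: sxs; rewrite !sorted_cat_cons => /andP[-> /= /and3P[]].
  move=> /asboolP[ltxy _ _] /asboolP[ltyz lezt _] ->; rewrite andbT.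
  apply/asboolP; split=> //; first exact: ltn_trans ltyz.
  by right; exists t => //; rewrite lezt leqnn.
- by move: lastxs; rewrite !last_cat.
- by case: p headxs {sxs lastxs allxs}.
- case: p allxs {sxs lastxs headxs} => [|w p] /=; first by case/and3P => _ -> ->.
  by rewrite !all_cat /= => /and5P[-> -> _ -> ->].
Qed.

Lemma prune_inv (t : nat) (xs ys : seq nat) :
  prune f k beta beta v t xs ys -> histogram_inv t xs -> histogram_inv t ys.
Proof.
by elim=> // {}xs {}ys zs /prune1_inv inv_ys _ IH /inv_ys.
Qed.

Lemma histogram_run_inv (X : nat -> seq nat) (t : nat) :
  histogram_run f k beta beta W v X -> histogram_inv t (X t).
Proof.
case=> X0 stepX; elim: t => [|t [sXt lastXt headXt _]]; first by rewrite X0.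
apply: prune_inv (stepX t) _; apply: expire_inv.
- case: (X t) sXt lastXt => //= x xs sxs lastxs.
  rewrite rcons_path lastxs; apply/andP; split.
    by apply: sub_path sxs => a b /asboolP /adjacentS /asboolP.
  (* The previous last index is [t], so the appended [t.+1] is consecutive to it. *)
  by apply/asboolP; split=> //; left.
- exact: last_rcons.
- case: (X t) lastXt headXt => [<- _|x xs _] /=; first by rewrite leq_maxl.
  move=> /leq_trans; apply; rewrite geq_max leq_maxl.
  by apply: leq_trans (leq_maxr _ _); apply: leq_sub2r.
Qed.

End Histogram.

Theorem theorem1 (R : realType) (V : finType) (f : {set V} -> R)
    (f_nonneg : nonneg_setfun f) (f_mono : monotone f)
    (f_submod : submodular f) (f_pos : forall u : V, 0 < f [set u])
    (k W : nat) (k_ge1 : (1 <= k)%N) (W_ge1 : (1 <= W)%N)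
    (eps : R) (eps_gt0 : 0 < eps) (v : nat -> V) (X : nat -> seq nat)
    (runX : histogram_run f k (eps / 2) (eps / 2) W v X)
    (t : nat) (t_ge1 : (1 <= t)%N) :
  let sol := solution f k (eps / 2) W v (X t) t in
  (1 / 3 - eps) * opt f k (window v W t) <= sol /\
  exists S : {set V}, [/\ S \subset window v W t, (#|S| <= k)%N & sol = f S].
Proof.
have beta_gt0 : 0 < eps / 2 by rewrite divr_gt0.
have [O [sO leOk ->]] := opt_attained f_nonneg k (window v W t).
set w := window_start W t.
have lewt : (w <= t)%N by rewrite /w /window_start; lia.
(* All cases reduce to [smooth_bound]. When the reported instance starts at [w], take [x = y = w]
   and [t' = t]; the inequality is then [self] below. *)
suff [x [y [t' [/andP[lexw lewy] leyt't smooth ->]]]] : exists x y t',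
    [/\ (x <= w <= y)%N, (y <= t' <= t)%N,
     (1 - eps / 2) * h f k (eps / 2) v x t' <= h f k (eps / 2) v y t'
   & solution f k (eps / 2) W v (X t) t = h f k (eps / 2) v y t].
  split.
    have -> : 1 / 3 - eps = 1 / 3 - 2 * (eps / 2) by field.
    apply: (smooth_bound f_nonneg f_mono f_submod f_pos _ _
      (leq_trans lexw lewy) leyt't smooth) => //.
    apply/subsetP => u /(subsetP sO); rewrite inE.
    case/mem_substream=> i /andP[lewi leit] ->.
    by apply/mem_substream; exists i => //; rewrite leit (leq_trans lexw).
  have leyt : (y <= t)%N by case/andP: leyt't => /leq_trans leyt /leyt.
  have [S [sS leSk ->]] := h_attained f_nonneg k (eps / 2) v leyt.
  exists S; split=> //; apply/subsetP => u /(subsetP sS).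
  case/mem_substream => i /andP[leyi leit] ->; rewrite inE.
  by apply/mem_substream; exists i => //; rewrite leit (leq_trans lewy).
have self y : (y <= t)%N ->
    (1 - eps / 2) * h f k (eps / 2) v y t <= h f k (eps / 2) v y t.
  move=> leyt; rewrite mulrBl mul1r gerBl mulr_ge0 ?(ltW beta_gt0) //.
  exact: h_ge0.
have := histogram_run_inv t runX; rewrite /solution -/w.
case: (X t) => [|x xs] [sX lastX headX allX].
  by move: t_ge1; rewrite -lastX.
have [xw|xw] := eqVneq (nth 0%N (x :: xs) 0) w.
  by exists w, w, t; rewrite /= in xw; rewrite /= xw !leqnn lewt; split=> //; apply: self.
(* A lone index is also the last, hence equals [t]; being at most [w <= t], it equals [w], against
   [xw]. *)
case: xs sX lastX headX allX xw => [/= _ -> |y xs] /=.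
  by rewrite -/w => lewt'; rewrite eqn_leq lewt lewt'.
case/andP => /asboolP[ltxy leyt adjxy] _ _ lexw /andP[ley _] nexw.
have lewy : (w <= y)%N.
  by rewrite /w /window_start geq_max ley andbT (leq_ltn_trans _ ltxy).
case: adjxy => [yE|[t' leyt't smooth]]; last first.
  by exists x, y, t'; rewrite lexw.
(* Consecutive indices with [x < w <= y] leave only [y = w]. *)
have yw : y = w by apply/eqP; rewrite eqn_leq lewy yE ltn_neqAle nexw lexw.
by exists y, y, t; rewrite {1}yw !leqnn leyt; split=> //; apply: self.
Qed.
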